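(* Let $(R,\mathfrak m)$ be a Noetherian (standard graded) local ring with $\mathfrak m$-adic completion $\widehat R$. Then $\operatorname{cs}(R)=\operatorname{cs}(\widehat R)$ and $\operatorname{ms}(R)=\operatorname{ms}(\widehat R)$.
   Context: All rings are commutative with unity. A ''Noetherian (standard graded) local ring $(R,\mathfrak m)$'' means either a Noetherian local ring with maximal ideal $\mathfrak m$, or a Noetherian standard graded ring $R=\bigoplus_{i\ge 0}R_i$ with $R_0$ a field, $R=R_0[R_1]$ and $\mathfrak m=\bigoplus_{i\ge1}R_i$; ''(homogeneous)'' applies in the graded case. Put $k=R/\mathfrak m$ and $\mu(I)=\dim_k(I/\mathfrak m I)$, the minimal number of generators of a (homogeneous) ideal $I$. Define $$\operatorname{cs}(R)=\min\{\mu(I): I\subseteq\mathfrak m \text{ a (homogeneous) ideal with } I^2=\mathfrak m^2\},$$ $$\operatorname{ms}(R)=\min\{\mu(I): I\subseteq \mathfrak m \text{ a (homogeneous) ideal with } I\supseteq \mathfrak m^2\}.$$ The completion $\widehat R$ is a Noetherian local ring with maximal ideal $\mathfrak m\widehat R$, and its invariants are those of a local ring. *)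

(* Defs.v *)
From HB Require Import structures.
From mathcomp Require Import all_boot all_algebra.
From mathcomp Require Import boolp classical_sets.

Set Implicit Arguments.
Unset Strict Implicit.
Unset Printing Implicit Defensive.

Import GRing.Theory.
Local Open Scope ring_scope.
Local Open Scope classical_set_scope.
Local Open Scope quotient_scope.

Section Ideals.
Variable R : comNzRingType.
Implicit Types (I J S : set R).

(* Unlike the library's [idealr R], this includes the unit ideal. *)
Definition ideal I :=
  [/\ I 0, forall x y, I x -> I y -> I (x + y) & forall a x, I x -> I (a * x)].

Definition ideal_gen S : set R := smallest ideal S.

Definition ideal_mul I J : set R :=
  ideal_gen [set z | exists x y, [/\ I x, J y & z = x * y]].

Definition ideal_pow I n : set R := iter n (ideal_mul I) setT.

Definition noetherian := forall I, ideal I -> exists s : seq R, I = ideal_gen [set` s].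

Definition maximal_ideal I :=
  [/\ ideal I, I <> setT
    & forall J, ideal J -> I `<=` J -> J = I \/ J = setT].

Definition local_ring (m : set R) := forall J, maximal_ideal J <-> J = m.

Lemma ideal_genP S : ideal (ideal_gen S).
Proof.
split=> [J [[J0 _ _] _] //|x y Sx Sy J JS|a x Sx J JS].
  by have [[_ JD _] _] := JS; apply: JD; [apply: Sx|apply: Sy].
by have [[_ _ JM] _] := JS; apply: JM; apply: Sx.
Qed.

Lemma ideal_pow_ideal I n : ideal (ideal_pow I n).
Proof. by case: n => [|n]; [split | exact: ideal_genP]. Qed.

Lemma ideal_mul_subl I J : ideal I -> ideal_mul I J `<=` I.
Proof.
move=> HI; apply: (smallest_sub HI) => z [x [y [Ix _ ->]]].
by rewrite mulrC; case: HI => _ _; apply.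
Qed.

Lemma ideal_mul_subr I J : ideal J -> ideal_mul I J `<=` J.
Proof.
move=> HJ; apply: (smallest_sub HJ) => z [x [y [_ Jy ->]]].
by case: HJ => _ _; apply.
Qed.

Lemma ideal_powS I n : ideal_pow I n.+1 `<=` ideal_pow I n.
Proof. by apply: ideal_mul_subr; apply: ideal_pow_ideal. Qed.

(* [has_mu m I n]: the R/m-vector space I/mI has a basis with n elements, i.e.
   mu(I) = dim_{R/m} (I/mI) = n.  Vectors and scalars are given by
   representatives in R: x represents the basis, the second clause says that
   the classes of the x i span I/mI, the third that they are linearly
   independent (a scalar vanishes in R/m iff it is in m). *)
Definition has_mu (m I : set R) (n : nat) :=
  exists x : 'I_n -> R,
  [/\ forall i, I (x i),
      forall y, I y ->
        exists a : 'I_n -> R, ideal_mul m I (y - \sum_(i < n) a i * x i)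
    & forall a : 'I_n -> R,
        ideal_mul m I (\sum_(i < n) a i * x i) -> forall i, m (a i)].

End Ideals.

(* The least element of S (and 0 if S is empty). *)
Definition min_nat (S : set nat) : nat :=
  xget 0%N [set n | S n /\ forall k, S k -> (n <= k)%N].

Section Invariants.
Variable R : comNzRingType.

(* P is the class of ideals under consideration: [@ideal R] in the local case,
   [homogeneous_ideal G] in the graded case.  In a Noetherian ring m itself is
   a candidate with finite mu(m), so the minima below are attained. *)
Definition cs (P : set (set R)) (m : set R) : nat :=
  min_nat [set n | exists I : set R,
    [/\ P I, I `<=` m, ideal_pow I 2 = ideal_pow m 2 & has_mu m I n]].

Definition ms (P : set (set R)) (m : set R) : nat :=
  min_nat [set n | exists I : set R,
    [/\ P I, I `<=` m, ideal_pow m 2 `<=` I & has_mu m I n]].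

End Invariants.

Section Graded.
Variables (R : comNzRingType) (G : nat -> set R).

Definition grading :=
  [/\ forall i, zmod_closed [in G i],
      G 0%N 1,
      forall i j x y, G i x -> G j y -> G (i + j)%N (x * y),
      forall x, exists (n : nat) (f : nat -> R),
        (forall i, G i (f i)) /\ x = \sum_(0 <= i < n) f i
    & forall (n : nat) (f : nat -> R), (forall i, G i (f i)) ->
        \sum_(0 <= i < n) f i = 0 -> forall i, (i < n)%N -> f i = 0].

Definition irrelevant_ideal : set R :=
  [set x | exists (n : nat) (f : nat -> R),
     (forall i, G i (f i)) /\ x = \sum_(1 <= i < n) f i].

Definition standard_graded :=
  [/\ grading,
      forall x, G 0%N x -> x != 0 -> exists2 y, G 0%N y & x * y = 1
    & smallest (fun S : set R => subring_closed [in S]) (G 0%N `|` G 1%N)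
        = setT].

Definition homogeneous_ideal (I : set R) :=
  ideal I /\
  forall (n : nat) (f : nat -> R), (forall i, G i (f i)) ->
    I (\sum_(0 <= i < n) f i) -> forall i, (i < n)%N -> I (f i).

End Graded.

Section Completion.
Variables (R : comNzRingType) (m : idealr R).

Lemma idealr_ideal : ideal [set` m].
Proof.
split=> /=; first exact: rpred0.
  by move=> x y; exact: rpredD.
by move=> a x; exact: idealMr.
Qed.

(* The exponent is shifted because the library only forms quotients by proper
   ideals; dropping R/m^0 = 0 does not change the inverse limit. *)
Definition powS_ideal (n : nat) : R -> bool :=
  fun x => `[< ideal_pow [set` m] n.+1 x >].

Lemma powS_idealP n : idealr_closed (powS_ideal n).
Proof.
have [p0 pD pM] := ideal_pow_ideal [set` m] n.+1.
split; first exact/asboolP.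
  apply/negP => /asboolP /(ideal_mul_subl idealr_ideal) /=.
  by rewrite idealr1.
move=> a x y /asboolP px /asboolP py; apply/asboolP.
by apply: pD => //; apply: pM.
Qed.

HB.instance Definition _ n :=
  isIdealr.Build R (powS_ideal n) (powS_idealP n).

Definition quo n := {ideal_quot (powS_ideal n : idealr R)}.
HB.instance Definition _ n := GRing.ComNzRing.on (quo n).
HB.instance Definition _ n := Quotient.on (quo n).

Definition transition n (q : quo n.+1) : quo n := \pi_(quo n) (repr q).

Lemma transition_pi n (x : R) :
  transition (\pi_(quo n.+1) x) = \pi_(quo n) x.
Proof.
apply/eqP; rewrite -Quotient.idealrBE.
have : repr (\pi_(quo n.+1) x) == x %[mod (quo n.+1)] by rewrite reprK.
rewrite -Quotient.idealrBE => /asboolP H.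
exact/asboolP/ideal_powS.
Qed.

(* The m-adic completion, as the inverse limit of the rings R/m^(n+1). *)
Definition completion :=
  {x : forall n, quo n | forall n, transition (x n.+1) = x n}.

HB.instance Definition _ := gen_eqMixin completion.
HB.instance Definition _ := gen_choiceMixin completion.

Lemma completion_ext (x y : completion) :
  (forall n, sval x n = sval y n) -> x = y.
Proof.
case: x y => [x hx] [y hy] /= exy.
have {}exy : x = y by apply: functional_extensionality_dep.
by subst y; congr exist; apply: Prop_irrelevance.
Qed.

Definition mk_completion (x : forall n, quo n)
  (hx : forall n, transition (x n.+1) = x n) : completion := exist _ x hx.

Definition to_completion (a : R) : completion :=
  mk_completion (fun n => transition_pi n a).

Lemma completion_opp_subproof (x : completion) n :
  transition (- sval x n.+1) = - sval x n.
Proof.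
rewrite -(svalP x n) -[sval x n.+1]reprK; move: (repr _) => a.
by rewrite -(rmorphN \pi_(quo n.+1)) !transition_pi rmorphN.
Qed.

Lemma completion_add_subproof (x y : completion) n :
  transition (sval x n.+1 + sval y n.+1) = sval x n + sval y n.
Proof.
rewrite -(svalP x n) -(svalP y n) -[sval x n.+1]reprK -[sval y n.+1]reprK.
move: (repr _) (repr _) => a b.
by rewrite -(rmorphD \pi_(quo n.+1)) !transition_pi rmorphD.
Qed.

Lemma completion_mul_subproof (x y : completion) n :
  transition (sval x n.+1 * sval y n.+1) = sval x n * sval y n.
Proof.
rewrite -(svalP x n) -(svalP y n) -[sval x n.+1]reprK -[sval y n.+1]reprK.
move: (repr _) (repr _) => a b.
by rewrite -(rmorphM \pi_(quo n.+1)) !transition_pi rmorphM.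
Qed.

Definition completion_opp x := mk_completion (completion_opp_subproof x).
Definition completion_add x y := mk_completion (completion_add_subproof x y).
Definition completion_mul x y := mk_completion (completion_mul_subproof x y).

Lemma completion_addA : associative completion_add.
Proof. by move=> x y z; apply: completion_ext => n /=; rewrite addrA. Qed.

Lemma completion_addC : commutative completion_add.
Proof. by move=> x y; apply: completion_ext => n /=; rewrite addrC. Qed.

Lemma completion_add0 : left_id (to_completion 0) completion_add.
Proof. by move=> x; apply: completion_ext => n /=; rewrite rmorph0 add0r. Qed.

Lemma completion_addN :
  left_inverse (to_completion 0) completion_opp completion_add.
Proof. by move=> x; apply: completion_ext => n /=; rewrite rmorph0 addNr. Qed.

HB.instance Definition _ := GRing.isZmodule.Build completion
  completion_addA completion_addC completion_add0 completion_addN.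

Lemma completion_mulA : associative completion_mul.
Proof. by move=> x y z; apply: completion_ext => n /=; rewrite mulrA. Qed.

Lemma completion_mulC : commutative completion_mul.
Proof. by move=> x y; apply: completion_ext => n /=; rewrite mulrC. Qed.

Lemma completion_mul1 : left_id (to_completion 1) completion_mul.
Proof. by move=> x; apply: completion_ext => n /=; rewrite rmorph1 mul1r. Qed.

Lemma completion_mulDl : left_distributive completion_mul +%R.
Proof. by move=> x y z; apply: completion_ext => n /=; rewrite mulrDl. Qed.

Lemma completion_one_neq0 : to_completion 1 != 0.
Proof.
apply/eqP => /(congr1 (fun x : completion => sval x 0%N)) /= /eqP.
by rewrite rmorph1 rmorph0 oner_eq0.
Qed.

HB.instance Definition _ := GRing.Zmodule_isComNzRing.Build completion
  completion_mulA completion_mulC completion_mul1 completion_mulDl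
  completion_one_neq0.

(* The extended ideal m R^, which is the maximal ideal of R^ when R is
   Noetherian and m is maximal. *)
Definition completion_max : set completion :=
  ideal_gen (to_completion @` [set` m]).

End Completion.

(* Main.v *)
(** Both invariants only depend on [R/m^3], which [R] and its completion share.
    For [ms], the ideals between [m^2] and [m] correspond to each other in the
    two rings, and in the graded case they are all homogeneous.  For [cs], an
    ideal [J] of the completion with [J^2 = m^2] is replaced by the ideal [I] of
    [R] generated by lifts (linear forms, in the graded case) of the classes of
    its generators in [m/m^2]: then [I^2 + m^3 = m^2], hence [I^2 = m^2] by
    Nakayama's lemma.  Since every spanning family of [I/mI] contains a basis,
    it is enough to bound the number of generators in both directions. *)

Require Import Defs.
From HB Require Import structures.
From mathcomp Require Import all_boot all_algebra.
From mathcomp Require Import boolp classical_sets.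
From mathcomp Require Import ring.

Set Implicit Arguments.
Unset Strict Implicit.
Unset Printing Implicit Defensive.

Import GRing.Theory.
Local Open Scope ring_scope.
Local Open Scope classical_set_scope.

(** * Ideals and numbers of generators *)

Section IdealTheory.
Variable R : comNzRingType.
Implicit Types (I J K L m S T : set R).

Lemma ideal_zero I : ideal I -> I 0. Proof. by case. Qed.

Lemma ideal_add I x y : ideal I -> I x -> I y -> I (x + y).
Proof. by case=> _ + _; apply. Qed.

Lemma ideal_scale I a x : ideal I -> I x -> I (a * x).
Proof. by case=> _ _; apply. Qed.

Lemma ideal_opp I x : ideal I -> I x -> I (- x).
Proof. by move=> idI Ix; rewrite -mulN1r; apply: ideal_scale. Qed.

Lemma ideal_sub I x y : ideal I -> I x -> I y -> I (x - y).
Proof. by move=> idI Ix Iy; apply: ideal_add => //; apply: ideal_opp. Qed.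

Lemma ideal_subKr I x y : ideal I -> I y -> I (x - y) -> I x.
Proof. by move=> idI Iy Ixy; rewrite -(subrK y x); apply: ideal_add. Qed.

Lemma ideal_sum {T : Type} {r : seq T} {P : pred T} {f : T -> R} I :
  ideal I -> (forall i, P i -> I (f i)) -> I (\sum_(i <- r | P i) f i).
Proof.
move=> idI If; elim/big_ind: _ => //; first exact: ideal_zero.
by move=> x y; apply: ideal_add.
Qed.

Lemma ideal_setT : ideal (setT : set R). Proof. by split. Qed.

(** With one factor of a product fixed, this lets the other factor range over generators only. *)
Lemma ideal_colon I y : ideal I -> ideal [set x | I (x * y)].
Proof.
move=> idI; split=> /= [|a b Ia Ib|a x Ix].
- by rewrite mul0r; apply: ideal_zero.
- by rewrite mulrDl; apply: ideal_add.
- by rewrite -mulrA; apply: ideal_scale.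
Qed.

Lemma sub_ideal_gen S : S `<=` ideal_gen S.
Proof. exact: sub_gen_smallest. Qed.

Lemma ideal_gen_sub S I : ideal I -> S `<=` I -> ideal_gen S `<=` I.
Proof. exact: smallest_sub. Qed.

Lemma ideal_gen_mono S T : S `<=` T -> ideal_gen S `<=` ideal_gen T.
Proof.
move=> ST; apply: ideal_gen_sub; first exact: ideal_genP.
by move=> x /ST; apply: sub_ideal_gen.
Qed.

Lemma ideal_mul_ideal I J : ideal (ideal_mul I J).
Proof. exact: ideal_genP. Qed.

Lemma ideal_mulM I J x y : I x -> J y -> ideal_mul I J (x * y).
Proof. by move=> Ix Jy; apply: sub_ideal_gen; exists x, y. Qed.

Lemma ideal_mul_sub I J K :
  ideal K -> (forall x y, I x -> J y -> K (x * y)) -> ideal_mul I J `<=` K.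
Proof.
by move=> idK IJK; apply: ideal_gen_sub => // _ [x [y [? ? ->]]]; apply: IJK.
Qed.

Lemma ideal_mul_mono I I' J J' :
  I `<=` I' -> J `<=` J' -> ideal_mul I J `<=` ideal_mul I' J'.
Proof.
move=> II' JJ'; apply: ideal_mul_sub; first exact: ideal_mul_ideal.
by move=> x y /II' ? /JJ' ?; apply: ideal_mulM.
Qed.

Lemma ideal_mul_gen_sub S T K :
  ideal K -> (forall x y, S x -> T y -> K (x * y)) ->
  ideal_mul (ideal_gen S) (ideal_gen T) `<=` K.
Proof.
move=> idK STK; apply: ideal_mul_sub => // x y Sx.
rewrite mulrC; move: y; apply: ideal_gen_sub; first exact: ideal_colon.
move=> y Ty /=; rewrite mulrC; move: x Sx.
apply: ideal_gen_sub; first exact: ideal_colon.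
by move=> x Sx; apply: STK.
Qed.

Lemma ideal_pow1 I : ideal I -> ideal_pow I 1 = I.
Proof.
move=> idI; apply/seteqP; split; first exact: ideal_mul_subl.
by move=> x Ix; rewrite -[x]mulr1; apply: ideal_mulM.
Qed.

Lemma ideal_powSE I n : ideal_pow I n.+1 = ideal_mul I (ideal_pow I n).
Proof. by []. Qed.

Lemma ideal_pow2 I : ideal I -> ideal_pow I 2 = ideal_mul I I.
Proof. by move=> idI; rewrite ideal_powSE ideal_pow1. Qed.

(** Allows an element of [I^(k+l)] to be written on generators of [I^l] with coefficients in
    [I^k]. *)
Lemma ideal_powD I k l :
  ideal_pow I (k + l) `<=` ideal_mul (ideal_pow I k) (ideal_pow I l).
Proof.
elim: k => [|k IHk].
  by move=> x Ix; rewrite -[x]mul1r; apply: ideal_mulM.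
rewrite addSn ideal_powSE; apply: ideal_mul_sub; first exact: ideal_mul_ideal.
move=> x y Ix /IHk; rewrite mulrC.
move: y; apply: ideal_mul_sub; first exact: (ideal_colon _ (ideal_mul_ideal _ _)).
move=> y z Iy Iz /=; have -> : y * z * x = (x * y) * z by ring.
by apply: ideal_mulM => //; apply: ideal_mulM.
Qed.

Lemma ideal_pow_le I k l : (k <= l)%N -> ideal_pow I l `<=` ideal_pow I k.
Proof.
move=> /subnK <-; elim: (l - k)%N => // n IHn x.
by rewrite addSn => /ideal_powS /IHn.
Qed.

Lemma ideal_mul_seqP I (s : seq R) x :
  ideal I -> ideal_mul I (ideal_gen [set` s]) x ->
  exists c : 'I_(size s) -> R,
    (forall i, I (c i)) /\ x = \sum_(i < size s) c i * s`_i.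
Proof.
move=> idI.
pose K : set R := [set x | exists c : 'I_(size s) -> R,
  (forall i, I (c i)) /\ x = \sum_(i < size s) c i * s`_i].
have idK : ideal K.
  split=> [|_ _ [c [Ic ->]] [d [Id ->]]|a _ [c [Ic ->]]].
  - exists (fun=> 0); split; first by move=> _; apply: ideal_zero.
    by rewrite big1 // => i _; rewrite mul0r.
  - exists (fun i => c i + d i); split; first by move=> i; apply: ideal_add.
    by rewrite -big_split; apply: eq_bigr => i _; rewrite mulrDl.
  - exists (fun i => a * c i); split; first by move=> i; apply: ideal_scale.
    by rewrite mulr_sumr; apply: eq_bigr => i _; rewrite mulrA.
suff : ideal_mul I (ideal_gen [set` s]) `<=` K by apply.
apply: ideal_mul_sub => // a y Ia; rewrite mulrC; move: y.
apply: ideal_gen_sub; first exact: ideal_colon.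
move=> y /= ys; have si : (index y s < size s)%N by rewrite index_mem.
(* The list may repeat [y], so the whole coefficient is put at its first occurrence. *)
exists (fun i => if i == Ordinal si then a else 0); split.
  by move=> i; case: eqP => // _; apply: ideal_zero.
rewrite (bigD1 (Ordinal si)) //= eqxx nth_index // big1 ?addr0 1?mulrC //.
by move=> i /negPf ->; rewrite mul0r.
Qed.

Definition ideal_plus I J : set R := [set z | exists2 x, I x & J (z - x)].

(* [R/m] is a field, or zero. *)
Definition residue_field m := forall a, ~ m a -> exists b, m (b * a - 1).

Definition spans_mod m I n (x : 'I_n -> R) :=
  (forall i, I (x i)) /\
  forall y, I y -> exists a : 'I_n -> R,
    ideal_mul m I (y - \sum_(i < n) a i * x i).

Lemma has_mu_spans m I n : has_mu m I n -> exists x : 'I_n -> R, spans_mod m I x.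
Proof. by case=> x [Ix Sx _]; exists x. Qed.

Lemma spans_has_mu m I n (x : 'I_n -> R) :
  ideal m -> residue_field m -> ideal I -> spans_mod m I x ->
  exists2 k, (k <= n)%N & has_mu m I k.
Proof.
move=> idm fm idI Sx.
pose P k := `[< exists y : 'I_k -> R, spans_mod m I y >].
have exP : exists k, P k by exists n; apply/asboolP; exists x.
(* A spanning family of least size is independent. *)
case: (ex_minnP exP) => k /asboolP[y [Iy Sy]] kmin.
exists k; first by apply: kmin; apply/asboolP; exists x.
have idmI := ideal_mul_ideal m I.
(* In a relation with some [a j] outside [m], the inverse [b] of [a j] modulo [m] expresses [y j]
   through the other vectors. Dropping [y j] contradicts minimality. *)
exists y; split=> // a Ia j; apply: contrapT => /fm [b mb].
case: k => [|k] in y Iy Sy kmin a Ia j mb *; first by case: j mb.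
suff : P k by move=> /kmin; rewrite ltnn.
apply/asboolP; exists (fun i => y (lift j i)); split=> // z /Sy [c Ic].
(* These coefficients come from substituting [- b * u] for [y j], where [u] is the rest of the
   relation. *)
exists (fun i => c (lift j i) - c j * b * a (lift j i)).
move: Ia Ic; rewrite (bigD1_ord j) //= (bigD1_ord j) //= => Ia Ic.
set u := \sum_(i < k) a (lift j i) * _ in Ia.
set v := \sum_(i < k) c (lift j i) * _ in Ic.
have -> : \sum_(i < k) (c (lift j i) - c j * b * a (lift j i)) * y (lift j i)
          = v - c j * b * u.
  rewrite /u /v mulr_sumr -sumrB; apply: eq_bigr => i _.
  by rewrite mulrBl !mulrA.
have -> : z - (v - c j * b * u) =
    (z - (c j * y j + v)) + (c j * b * (a j * y j + u)
    - c j * ((b * a j - 1) * y j)) by ring.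
apply: (ideal_add idmI Ic); apply: (ideal_sub idmI).
  exact: (ideal_scale _ idmI).
by apply: (ideal_scale _ idmI); apply: ideal_mulM.
Qed.

Lemma spans_gen m I n (x : 'I_n -> R) :
  ideal m -> I = ideal_gen (range x) -> spans_mod m I x.
Proof.
move=> idm ->; split=> [i|]; first by apply: sub_ideal_gen; exists i.
pose K : set R := [set y | exists a : 'I_n -> R, y = \sum_(i < n) a i * x i].
suff KI : ideal_gen (range x) `<=` K.
  by move=> y /KI [a ->]; exists a; rewrite subrr; exact: (ideal_zero (ideal_genP _)).
apply: ideal_gen_sub.
  split=> [|_ _ [a ->] [b ->]|c _ [a ->]].
  - by exists (fun=> 0); rewrite big1 // => i _; rewrite mul0r.
  - exists (fun i => a i + b i); rewrite -big_split.
    by apply: eq_bigr => i _; rewrite mulrDl.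
  - exists (fun i => c * a i); rewrite mulr_sumr.
    by apply: eq_bigr => i _; rewrite mulrA.
move=> _ [i _ <-]; exists (fun j => (j == i)%:R).
rewrite (bigD1 i) //= eqxx mul1r big1 ?addr0 // => j /negPf ->.
by rewrite mul0r.
Qed.

End IdealTheory.

(** Mutual domination gives both sets the same least elements, so no separate nonemptiness argument
    is needed. *)
Lemma min_nat_eq (S T : set nat) :
  (forall n, S n -> exists2 k, (k <= n)%N & T k) ->
  (forall n, T n -> exists2 k, (k <= n)%N & S k) ->
  min_nat S = min_nat T.
Proof.
move=> ST TS; rewrite /min_nat; congr xget; apply/seteqP.
suff H (A B : set nat) : (forall n, A n -> exists2 k, (k <= n)%N & B k) ->
    (forall n, B n -> exists2 k, (k <= n)%N & A k) ->
    [set n | A n /\ forall k, A k -> (n <= k)%N] `<=`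
    [set n | B n /\ forall k, B k -> (n <= k)%N] by split; apply: H.
move=> AB BA n /= [An nmin]; have [k kn Bk] := AB _ An.
have nB l : B l -> (n <= l)%N.
  by move=> /BA [i il /nmin ni]; apply: leq_trans il.
by split=> //; have /eqP -> : n == k; rewrite // eqn_leq kn nB.
Qed.

(** * Transfer along a ring morphism which is bijective modulo [m^3] *)

Section Transfer.
Variables (R S : comNzRingType) (phi : {rmorphism R -> S}).
Implicit Types (I : set R) (J : set S).

Definition extension I : set S := ideal_gen (phi @` I).

Lemma extension_mul I I' :
  extension (ideal_mul I I') = ideal_mul (extension I) (extension I').
Proof.
apply/seteqP; split.
  apply: ideal_gen_sub; first exact: ideal_mul_ideal.
  move=> _ [x Ix <-]; move: x Ix; set K := ideal_mul (extension I) _.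
  have idK : ideal K by apply: ideal_mul_ideal.
  apply: (ideal_mul_sub (K := phi @^-1` K)).
    split=> /= [|x y Kx Ky|a x Kx]; rewrite ?rmorph0 ?rmorphD ?rmorphM.
    - exact: (ideal_zero idK).
    - exact: (ideal_add idK).
    - exact: (ideal_scale _ idK).
  move=> x y Ix Iy /=; rewrite rmorphM.
  by apply: ideal_mulM; apply: sub_ideal_gen; [exists x|exists y].
apply: ideal_mul_gen_sub; first exact: ideal_genP.
move=> _ _ [x Ix <-] [y Iy <-]; rewrite -rmorphM; apply: sub_ideal_gen.
by exists (x * y) => //; apply: ideal_mulM.
Qed.

Lemma extension_pow I n : extension (ideal_pow I n) = ideal_pow (extension I) n.
Proof.
elim: n => [|n IHn]; last by rewrite ideal_powSE extension_mul IHn.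
apply/seteqP; split=> // x _; rewrite -[x]mulr1; apply: (ideal_scale _ (ideal_genP _)).
by apply: sub_ideal_gen; exists 1; rewrite ?rmorph1.
Qed.

Lemma ideal_preimage J : ideal J -> ideal (phi @^-1` J).
Proof.
move=> idJ; split=> /= [|x y Jx Jy|a x Jx]; rewrite ?rmorph0 ?rmorphD ?rmorphM.
- exact: ideal_zero.
- exact: ideal_add.
- exact: ideal_scale.
Qed.

Variable m : set R.
Hypothesis idm : ideal m.
Let M := extension m.
Hypothesis dense : forall z, exists y, ideal_pow M 3 (z - phi y).
Hypothesis preim3 : phi @^-1` ideal_pow M 3 `<=` ideal_pow m 3.
Hypothesis resm : residue_field m.

Let idM : ideal M. Proof. exact: ideal_genP. Qed.

Let M21 : ideal_pow M 2 `<=` M.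
Proof. by rewrite ideal_pow2 //; apply: ideal_mul_subl. Qed.

Let M31 : ideal_pow M 3 `<=` M.
Proof. by move=> x /ideal_powS /M21. Qed.

Let phiM n x : ideal_pow m n x -> ideal_pow M n (phi x).
Proof. by move=> mx; rewrite -extension_pow; apply: sub_ideal_gen; exists x. Qed.

Let phi1 x : m x -> M (phi x).
Proof. by move=> mx; apply: sub_ideal_gen; exists x. Qed.

(** This is [phi(I) + M^n]. For [n <= 3] no extension of [I] has to be taken, since [phi] is onto
    modulo [M^3]. *)
Definition near I n : set S := [set z | exists2 w, I w & ideal_pow M n (z - phi w)].

Lemma near_ideal I n : (n <= 3)%N -> ideal I -> ideal (near I n).
Proof.
move=> n3 idI; have idMn := ideal_pow_ideal M n.
split=> [|x y [a Ia Ma] [b Ib Mb]|a x [b Ib Mb]].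
- exists 0; first exact: ideal_zero.
  by rewrite rmorph0 subr0; apply: (ideal_zero idMn).
- exists (a + b); first exact: ideal_add.
  by rewrite rmorphD opprD addrACA; apply: (ideal_add idMn).
(* A scalar of [S] is replaced by the image of a scalar of [R], at the cost of an error in [M^n]. *)
- have [c /(ideal_pow_le n3) Mc] := dense a.
  exists (c * b); first exact: ideal_scale.
  have -> : a * x - phi (c * b) = a * (x - phi b) + phi b * (a - phi c).
    by rewrite rmorphM; ring.
  by apply: (ideal_add idMn); apply: (ideal_scale _ idMn).
Qed.

Lemma near_phi I n x : I x -> near I n (phi x).
Proof.
move=> Ix; exists x => //; rewrite subrr; exact: (ideal_zero (ideal_pow_ideal _ _)).
Qed.

Lemma near_pow I n x : ideal I -> ideal_pow M n x -> near I n x.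
Proof.
by move=> idI Mx; exists 0; [apply: ideal_zero|rewrite rmorph0 subr0].
Qed.

Lemma near_preimage I x :
  ideal I -> ideal_pow m 3 `<=` I -> near I 3 (phi x) -> I x.
Proof.
move=> idI m3I [w Iw]; rewrite -rmorphB => /preim3 /m3I Ixw.
exact: ideal_subKr Ixw.
Qed.

(** Each error term in [M^n] is multiplied by an element of [M], so the product is approximated one
    order better. *)
Lemma near_mul I I' J J' n :
  J `<=` near I n -> J' `<=` near I' n -> J `<=` M -> I' `<=` m ->
  (n.+1 <= 3)%N -> ideal I -> ideal I' ->
  ideal_mul J J' `<=` near (ideal_mul I I') n.+1.
Proof.
move=> JI JI' JM Im n3 idI idI'.
apply: ideal_mul_sub; first exact: (near_ideal n3 (ideal_mul_ideal _ _)).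
move=> x y Jx Jy; have [w Iw Mw] := JI _ Jx; have [v Iv Mv] := JI' _ Jy.
exists (w * v); first exact: ideal_mulM.
have -> : x * y - phi (w * v) = x * (y - phi v) + phi v * (x - phi w).
  by rewrite rmorphM; ring.
apply: (ideal_add (ideal_pow_ideal M n.+1)).
  by apply: ideal_mulM => //; apply: JM.
by apply: ideal_mulM => //; apply: phi1; apply: Im.
Qed.

Lemma extension_near I : ideal I -> extension I `<=` near I 3.
Proof.
move=> idI; apply: ideal_gen_sub; first by apply: near_ideal.
by move=> _ [x Ix <-]; apply: near_phi.
Qed.

Lemma near_le I k l : (k <= l)%N -> near I l `<=` near I k.
Proof. by move=> kl z [w Iw Mw]; exists w => //; apply: ideal_pow_le Mw. Qed.

Let preim1 x : M (phi x) -> m x.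
Proof.
move=> /(extension_near idm); apply: near_preimage => // y.
by move=> /(@ideal_pow_le _ _ 1 3 isT); rewrite ideal_pow1.
Qed.

(** An inverse modulo [M] is the image of an inverse modulo [m] of an approximation of [a]. *)
Lemma extension_residue_field : residue_field M.
Proof.
move=> a nMa; have [y My] := dense a.
have [b mb] : exists b, m (b * y - 1).
  by apply: resm => /phi1 Mphi; apply: nMa; apply: (ideal_subKr idM _ (M31 My)).
exists (phi b).
have -> : phi b * a - 1 = phi b * (a - phi y) + phi (b * y - 1).
  by rewrite rmorphB rmorphM rmorph1; ring.
by apply: (ideal_add idM); [apply: (ideal_scale _ idM); apply: M31|apply: phi1].
Qed.

(** * Comparison of the ideals that contain the square of the maximal ideal *)

Lemma ms_extend I n :
  ideal I -> I `<=` m -> ideal_pow m 2 `<=` I -> has_mu m I n ->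
  exists2 k, (k <= n)%N & exists J,
    [/\ ideal J, J `<=` M, ideal_pow M 2 `<=` J & has_mu M J k].
Proof.
move=> idI Im m2I /has_mu_spans [x [Ix Sx]]; set J := near I 3.
have idJ : ideal J by apply: near_ideal.
have M2J : ideal_pow M 2 `<=` J.
  rewrite -extension_pow => y /(extension_near (ideal_pow_ideal m 2)).
  by case=> w /m2I Iw Mw; exists w.
have SJ : spans_mod M J (phi \o x).
  split=> [i|z [w Iw Mw]] /=; first exact: near_phi.
  have [a Ia] := Sx _ Iw; exists (phi \o a) => /=.
  have -> : z - \sum_(i < n) phi (a i) * phi (x i) =
      (z - phi w) + phi (w - \sum_(i < n) a i * x i).
    rewrite rmorphB rmorph_sum addrA subrK; congr (_ - _).
    by apply: eq_bigr => i _; rewrite rmorphM.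
  (* The approximation error is harmless: [M^2] lies in [J], hence [M^3] lies in [M J]. *)
  apply: (ideal_add (ideal_mul_ideal M J)).
    by apply: ideal_mul_mono Mw.
  move: Ia; apply: (ideal_mul_sub (ideal_preimage (ideal_mul_ideal M J))).
  by move=> u v mu Iv /=; rewrite rmorphM; apply: ideal_mulM; [apply: phi1|apply: near_phi].
have [k kn muJ] := spans_has_mu idM extension_residue_field idJ SJ.
exists k => //; exists J; split=> // z [w /Im /phi1 Mw /M31 Mzw].
exact: (ideal_subKr idM Mw Mzw).
Qed.

(** Generators of [J] are approximated modulo [M^3]. This error lies in [M J], and relations modulo
    [M J] pull back to relations modulo [m I]. *)
Lemma ms_restrict J n :
  ideal J -> J `<=` M -> ideal_pow M 2 `<=` J -> has_mu M J n ->
  exists2 k, (k <= n)%N & exists I,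
    [/\ ideal I, I `<=` m, ideal_pow m 2 `<=` I & has_mu m I k].
Proof.
move=> idJ JM M2J /has_mu_spans [z [Jz Sz]]; set I := phi @^-1` J.
have idI : ideal I by apply: ideal_preimage.
have Im : I `<=` m by move=> x /JM /preim1.
have m2I : ideal_pow m 2 `<=` I by move=> x /phiM /M2J.
have idMJ := ideal_mul_ideal M J.
have M3MJ : ideal_pow M 3 `<=` ideal_mul M J by apply: ideal_mul_mono.
have JI : J `<=` near I 3.
  move=> u Ju; have [w Mw] := dense u; exists w => //.
  rewrite /I /= -(subKr u (phi w)); apply: ideal_sub => //.
  exact: ideal_mul_subr (M3MJ _ Mw).
have MJI : ideal_mul M J `<=` near (ideal_mul m I) 3.
  apply: near_mul => //.
    by move=> u /(extension_near idm); apply: near_le.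
  by move=> u /JI; apply: near_le.
have [y My] := choice (fun i => dense (z i)).
have Iy i : I (y i).
  rewrite /I /= -(subKr (z i) (phi _)); apply: ideal_sub => //.
  exact: ideal_mul_subr (M3MJ _ (My i)).
have SI : spans_mod m I y.
  split=> // x Ix; have [a Ja] := Sz _ Ix.
  have [b Mb] := choice (fun i => dense (a i)); exists b.
  apply: near_preimage; first exact: ideal_mul_ideal.
    by apply: ideal_mul_mono.
  apply: MJI.
  (* Both the coefficients and the generators are replaced by approximations, and every correction
     stays in [M J]. *)
  have -> : phi (x - \sum_(i < n) b i * y i) =
    (phi x - \sum_(i < n) a i * z i) +
    \sum_(i < n) (a i * (z i - phi (y i)) + (a i - phi (b i)) * phi (y i)).
    rewrite rmorphB rmorph_sum -addrA; congr (_ + _); apply: (canRL (addKr _)).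
    rewrite -sumrB; apply: eq_bigr => i _; rewrite rmorphM.
    ring.
  apply: (ideal_add idMJ) => //. apply: (ideal_sum idMJ) => i _.
  apply: (ideal_add idMJ); first by apply: (ideal_scale _ idMJ); apply: M3MJ.
  by apply: ideal_mulM; [apply: M31|apply: Iy].
have [k kn muI] := spans_has_mu idm resm idI SI.
by exists k => //; exists I.
Qed.

(** * Comparison of the ideals whose square is the square of the maximal ideal *)

Lemma cs_extend I n :
  ideal I -> I `<=` m -> ideal_pow I 2 = ideal_pow m 2 -> has_mu m I n ->
  exists2 k, (k <= n)%N & exists J,
    [/\ ideal J, J `<=` M, ideal_pow J 2 = ideal_pow M 2 & has_mu M J k].
Proof.
move=> idI Im I2 /has_mu_spans [x [Ix Sx]]; set J := extension I.
have idJ : ideal J by apply: ideal_genP.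
have idMJ := ideal_mul_ideal M J.
have Jphi y : I y -> J (phi y) by move=> Iy; apply: sub_ideal_gen; exists y.
have SJ : spans_mod M J (phi \o x).
  split=> [i|z]; first exact: Jphi.
  pose K : set S := [set z | exists a, ideal_mul M J (z - \sum_(i < n) a i * phi (x i))].
  suff : J `<=` K by apply.
  apply: ideal_gen_sub.
    split=> [|u v [a Ka] [b Kb]|c u [a Ka]].
    - exists (fun=> 0); rewrite big1 ?subr0 => [|i _]; last by rewrite mul0r.
      exact: (ideal_zero idMJ).
    - exists (fun i => a i + b i).
      under eq_bigr do rewrite mulrDl.
      by rewrite big_split opprD addrACA; apply: (ideal_add idMJ).
    - exists (fun i => c * a i).
      under eq_bigr do rewrite -mulrA.
      by rewrite -mulr_sumr -mulrBr; apply: (ideal_scale _ idMJ).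
  move=> _ [y Iy <-]; have [a Ia] := Sx _ Iy; exists (phi \o a).
  under eq_bigr do rewrite -rmorphM.
  rewrite -rmorph_sum -rmorphB; move: Ia.
  apply: (ideal_mul_sub (ideal_preimage idMJ)) => u v mu Iv /=.
  by rewrite rmorphM; apply: ideal_mulM; [apply: phi1|apply: Jphi].
have [k kn muJ] := spans_has_mu idM extension_residue_field idJ SJ.
exists k => //; exists J; split=> //; last by rewrite -!extension_pow I2.
by apply: ideal_gen_mono => _ [y /Im my <-]; exists y.
Qed.

(* The ideal of [R] is generated by lifts of the linear parts of the
   generators of [J]; [D] restricts the choice of the lifts, and the last
   hypothesis on [D] is a form of Nakayama's lemma. *)
Lemma cs_restrict (P : set (set R)) (D : set R) J n :
  (forall x, m x -> exists2 y, D y & ideal_pow m 2 (x - y)) ->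
  (forall k (y : 'I_k -> R), (forall i, D (y i)) -> (forall i, m (y i)) ->
     let I := ideal_gen (range y) in
     ideal_pow m 2 `<=` ideal_plus (ideal_mul I I) (ideal_pow m 3) ->
     P I /\ ideal_pow m 2 `<=` ideal_mul I I) ->
  ideal J -> J `<=` M -> ideal_pow J 2 = ideal_pow M 2 -> has_mu M J n ->
  exists2 k, (k <= n)%N & exists I,
    [/\ P I, I `<=` m, ideal_pow I 2 = ideal_pow m 2 & has_mu m I k].
Proof.
move=> lift nak idJ JM J2 /has_mu_spans [z [Jz Sz]].
have idM2 := ideal_pow_ideal M 2.
(* Moving the lift into [D] changes it by an element of [m^2], so the congruence with [z i] is kept
   only modulo [M^2]. *)
have /choice [y Dy] i : exists y, [/\ D y, m y & ideal_pow M 2 (z i - phi y)].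
  have [u Mu] := dense (z i).
  have mu : m u.
    apply: preim1; rewrite -(subKr (z i) (phi u)).
    by apply: (ideal_sub idM); [apply: JM|apply: M31].
  have [y Dy muy] := lift _ mu; exists y; split=> //.
    rewrite -(subKr u y); apply: ideal_sub => //.
    by move: muy; rewrite ideal_pow2 //; apply: ideal_mul_subl.
  rewrite -(subrK (phi u) (z i)) -addrA -rmorphB.
  by apply: (ideal_add idM2); [apply: ideal_powS|apply: phiM].
set I := ideal_gen (range y); have idI : ideal I by apply: ideal_genP.
have Im : I `<=` m.
  by apply: ideal_gen_sub => // _ [i _ <-]; case: (Dy i).
have JI : J `<=` near I 2.
  have idN : ideal (near I 2) by apply: near_ideal.
  move=> u /Sz [a Ja]; apply: (ideal_subKr (y := \sum_(i < n) a i * z i) idN).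
    apply: (ideal_sum idN) => i _; apply: (ideal_scale _ idN).
    by exists (y i); [apply: sub_ideal_gen; exists i|case: (Dy i)].
  by apply: near_pow => //; rewrite ideal_pow2 //; move: Ja; apply: ideal_mul_mono.
(* Congruence modulo [M^2] suffices here, because multiplying two elements of [J] raises the
   precision to [M^3]. *)
have I2 : ideal_pow m 2 `<=` ideal_plus (ideal_mul I I) (ideal_pow m 3).
  move=> x /phiM; rewrite -J2 ideal_pow2 // => /(near_mul JI JI JM Im isT idI idI).
  by case=> w Iw; rewrite -rmorphB => /preim3; exists w.
have [||PI m2I] := nak n y _ _ I2; try by move=> i; case: (Dy i).
have [k kn muI] := spans_has_mu idm resm idI (spans_gen (n := n) idm erefl).
exists k => //; exists I; split=> //; rewrite (ideal_pow2 idI).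
apply/seteqP; split=> //; rewrite ideal_pow2 //.
exact: ideal_mul_mono.
Qed.

End Transfer.

(** * The completion *)

Section CompletionTheory.
Local Open Scope quotient_scope.
Variables (R : comNzRingType) (m : idealr R).

Local Notation mset := [set` m].
Local Notation pi n := (\pi_(quo m n)).
Local Notation mhat := (@completion_max R m).

Lemma to_completion_zmod_morphism : zmod_morphism (@to_completion R m).
Proof. by move=> x y; apply: completion_ext => n /=; rewrite rmorphB. Qed.

Lemma to_completion_monoid_morphism : monoid_morphism (@to_completion R m).
Proof.
by split=> // x y; apply: completion_ext => n /=; rewrite rmorphM.
Qed.

HB.instance Definition _ := GRing.isZmodMorphism.Build R (completion m)
  (@to_completion R m) to_completion_zmod_morphism.
HB.instance Definition _ := GRing.isMonoidMorphism.Build R (completion m)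
  (@to_completion R m) to_completion_monoid_morphism.

Lemma quo_eqP n x y : pi n x = pi n y <-> ideal_pow mset n.+1 (x - y).
Proof.
split=> [/eqP|H]; first by rewrite -Quotient.idealrBE => /asboolP.
by apply/eqP; rewrite -Quotient.idealrBE; apply/asboolP.
Qed.

Lemma sval_sum (T : Type) (r : seq T) (F : T -> completion m) n :
  sval (\sum_(i <- r) F i) n = \sum_(i <- r) sval (F i) n.
Proof.
apply: (big_morph (fun z : completion m => sval z n)) => //.
exact: (rmorph0 (pi n)).
Qed.

(** The power [mhat^(n+1)] is the extension of [m^(n+1)], whose generators vanish in the quotient of
    index [n], that is in [R/m^(n+1)]. *)
Lemma sval_extension n z :
  ideal_pow mhat n.+1 z -> sval z n = 0.
Proof.
rewrite /completion_max -/(extension (@to_completion R m) mset) -extension_pow.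
move: z; apply: ideal_gen_sub.
  split=> [|x y /= xn yn|a x /= xn].
  - exact: (rmorph0 (pi n)).
  - by rewrite xn yn addr0.
  - by rewrite xn mulr0.
move=> _ [x xm <-] /=; rewrite -(rmorph0 (pi n)); apply/quo_eqP.
by rewrite subr0.
Qed.

Lemma to_completion_preimage n x :
  ideal_pow mhat n.+1 (to_completion m x) ->
  ideal_pow mset n.+1 x.
Proof.
move=> /sval_extension /=; rewrite -(rmorph0 (pi n)) => /quo_eqP.
by rewrite subr0.
Qed.

Lemma repr_sval_step (z : completion m) n :
  ideal_pow mset n.+1 (repr (sval z n.+1) - repr (sval z n)).
Proof. by apply/quo_eqP; rewrite -/(transition _) reprK; apply: (svalP z). Qed.

Lemma pi_repr_sval (z : completion m) n k :
  pi n (repr (sval z (k + n)%N)) = sval z n.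
Proof.
elim: k => [|k IHk]; first by rewrite reprK.
rewrite -IHk; apply/quo_eqP; rewrite addSn.
have le : (n.+1 <= (k + n).+1)%N by rewrite ltnS leq_addl.
exact: (ideal_pow_le le (@repr_sval_step z (k + n)%N)).
Qed.

(* The coefficients of [z] on generators of [m^(N+1)] are sums of series whose
   terms are the coefficients of the successive differences of representatives
   of [z]; these differences lie in [m^k m^(N+1)]. *)
Lemma completion_kernel N (z : completion m) :
  noetherian R -> sval z N = 0 ->
  extension (@to_completion R m) (ideal_pow mset N.+1) z.
Proof.
move=> noeth zN; set y := fun k => repr (sval z k).
have [s Is] := noeth _ (ideal_pow_ideal mset N.+1).
have [c0 [_ c0E]] : exists c : 'I_(size s) -> R,
    (forall i, setT (c i)) /\ y N = \sum_(i < size s) c i * s`_i.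
  apply: ideal_mul_seqP; first exact: ideal_setT.
  rewrite -Is -[y N]mul1r; apply: ideal_mulM => //.
  by rewrite -[y N]subr0; apply/quo_eqP; rewrite reprK rmorph0.
(* The difference lies in [m^(N+k+1)], which is contained in [m^k m^(N+1)]. *)
have /choice [c cE] k : exists c : 'I_(size s) -> R,
    (forall i, ideal_pow mset k (c i)) /\
    y (N + k.+1)%N - y (N + k)%N = \sum_(i < size s) c i * s`_i.
  apply: ideal_mul_seqP; first exact: ideal_pow_ideal.
  rewrite -Is; apply: ideal_powD; rewrite !addnS addnC.
  exact: repr_sval_step.
(* Summing up to [k = n] makes consecutive partial sums differ by [c n.+1 i], an element of
   [m^(n+1)], as compatibility in [R/m^(n+1)] requires. *)
pose u i n := c0 i + \sum_(0 <= k < n.+1) c k i.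
have uP i n : transition (pi n.+1 (u i n.+1)) = pi n (u i n).
  rewrite transition_pi; apply/quo_eqP.
  rewrite /u (big_nat_recr n.+1) //= addrA [X in X - _]addrC addrK.
  by have [cn _] := cE n.+1; apply: cn.
pose w i : completion m := mk_completion (uP i).
have -> : z = \sum_(i < size s) w i * to_completion m s`_i.
  apply: completion_ext => n; rewrite sval_sum /=.
  (* Component [n] of [z] is read off the later representative [y (N + n.+1)], where the telescoping
     sum ends. *)
  rewrite -(pi_repr_sval z n N.+1) -/(y _) addSnnS.
  under [RHS]eq_bigr do rewrite -rmorphM.
  rewrite -rmorph_sum; congr (pi n _).
  have := telescope_sumr (fun k => y (N + k)%N) (leq0n n.+1).
  rewrite addn0 => /(canLR (subrK _)) <-; rewrite c0E addrC.
  under [RHS]eq_bigr do rewrite mulrDl mulr_suml.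
  rewrite [RHS]big_split exchange_big /=; congr (_ + _).
  by apply: eq_bigr => k _; case: (cE k).
apply: (ideal_sum (ideal_genP _)) => i _; apply: (ideal_scale _ (ideal_genP _)).
apply: sub_ideal_gen; exists s`_i => //; rewrite Is.
by apply: sub_ideal_gen => /=; apply: mem_nth.
Qed.

Lemma to_completion_dense N (z : completion m) : noetherian R ->
  exists y, ideal_pow mhat N.+1 (z - to_completion m y).
Proof.
move=> noeth; exists (repr (sval z N)).
rewrite /completion_max -/(extension (@to_completion R m) mset) -extension_pow.
by apply: completion_kernel => //=; rewrite reprK subrr.
Qed.

End CompletionTheory.

(** * Local rings *)

Section Local.
Variable R : comNzRingType.
Implicit Types (I J K L m : set R).

Lemma ideal_eqT I : ideal I -> I 1 -> I = setT.
Proof.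
move=> idI I1; apply/seteqP; split=> // x _; rewrite -[x]mulr1.
exact: (ideal_scale _ idI).
Qed.

(** Zorn's lemma is applied to the sets [X] for which [J] united with [X] is a proper ideal. The
    empty chain then causes no trouble, since its union gives back [J]. *)
Lemma maximal_ideal_exists J :
  ideal J -> ~ J 1 -> exists2 K, maximal_ideal K & J `<=` K.
Proof.
move=> idJ nJ1.
pose P : set (set R) := [set X | ideal (J `|` X) /\ ~ (J `|` X) 1].
have [F FP Ftot|A [[idA nA1] Amax]] := @Zorn_bigcup R P.
  (* Adjoining the empty set to the chain makes it nonempty, and elements of [J] are then covered by
     the member [set0]. *)
  have PF X : (F `|` [set set0]) X -> P X.
    by case=> [/FP //|->]; split; rewrite setU0.
  have tot X Y : (F `|` [set set0]) X -> (F `|` [set set0]) Y ->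
      X `<=` Y \/ Y `<=` X.
    move=> [FX|->] [FY|->]; [exact: Ftot|right|left|left] => //.
  have inF x : (J `|` \bigcup_(X in F) X) x ->
      exists2 X, (F `|` [set set0]) X & (J `|` X) x.
    by case=> [Jx|[X FX Xx]]; [exists set0; [right|left]|exists X; [left|right]].
  have outF X : (F `|` [set set0]) X -> J `|` X `<=` J `|` \bigcup_(X in F) X.
    by case=> [FX|->] x [Jx|Xx]; [left|right; exists X|left|].
  split; last by move=> /inF[X /PF[_ nX1]].
  split=> [|x y /inF[X FX Xx] /inF[Y FY Yy]|a x /inF[X FX Xx]].
  - by left; apply: ideal_zero.
  - have [XY|YX] := tot _ _ FX FY.
      apply: (outF _ FY); apply: (ideal_add (PF _ FY).1) => //.
      by case: Xx => [|/XY]; [left|right].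
    apply: (outF _ FX); apply: (ideal_add (PF _ FX).1) => //.
    by case: Yy => [|/YX]; [left|right].
  - by apply: (outF _ FX); apply: (ideal_scale _ (PF _ FX).1).
exists (J `|` A); last by move=> x; left.
split=> // [AT|L idL AL]; first by apply: nA1; rewrite AT.
have [L1|nL1] := pselect (L 1); [by right; apply: ideal_eqT|left].
have JL : J `|` L = L by apply/seteqP; split=> x; [case=> // Jx; apply: AL; left|right].
apply/seteqP; split=> // x Lx; right; apply: contrapT => nAx.
apply: (Amax L); last by split; rewrite JL.
by split=> [y Ay|/(_ _ Lx)//]; apply: AL; right.
Qed.

(** If [1 - a] generated a proper ideal, it would lie in [m] together with [a], and so would [1]. *)
Lemma local_ring_unit m a :
  local_ring m -> m a -> exists u, u * (1 - a) = 1.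
Proof.
move=> Rloc ma.
have [idm mT _] : maximal_ideal m by apply/Rloc.
pose J : set R := [set x | exists u, x = u * (1 - a)].
have idJ : ideal J.
  split=> [|_ _ [u ->] [v ->]|b _ [u ->]].
  - by exists 0; rewrite mul0r.
  - by exists (u + v); rewrite mulrDl.
  - by exists (b * u); rewrite mulrA.
have [[u J1]|nJ1] := pselect (J 1); first by exists u.
have [K /Rloc -> Jm] := maximal_ideal_exists idJ nJ1.
case: mT; apply: ideal_eqT => //; rewrite -(subrK a 1).
by apply: (ideal_add idm) => //; apply: Jm; exists 1; rewrite mul1r.
Qed.

(** The ideal [J = m + (a)] strictly contains [m], so it contains [1]. *)
Lemma maximal_residue_field m : maximal_ideal m -> residue_field m.
Proof.
move=> [idm mT mmax] a nma.
pose J : set R := [set x | exists b, m (x - b * a)].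
have idJ : ideal J.
  split=> [|x y [b mb] [c mc]|c x [b mb]].
  - by exists 0; rewrite mul0r subr0; apply: ideal_zero.
  - by exists (b + c); rewrite mulrDl opprD addrACA; apply: ideal_add.
  - by exists (c * b); rewrite -mulrA -mulrBr; apply: ideal_scale.
have mJ : m `<=` J by move=> x mx; exists 0; rewrite mul0r subr0.
have Ja : J a by exists 1; rewrite mul1r subrr; apply: ideal_zero.
have [Jm|JT] := mmax _ idJ mJ; first by case: nma; rewrite -Jm.
have [b mb] : J 1 by rewrite JT.
by exists b; rewrite -opprB; apply: ideal_opp.
Qed.

Lemma ideal_mul_cons m (x : R) (s : seq R) z : ideal m ->
  ideal_mul m (ideal_gen [set` x :: s]) z ->
  exists2 a, m a & ideal_mul m (ideal_gen [set` s]) (z - a * x).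
Proof.
move=> idm; set N := ideal_mul m (ideal_gen [set` s]).
have idN : ideal N by apply: ideal_mul_ideal.
pose K : set R := [set z | exists2 a, m a & N (z - a * x)].
have idK : ideal K.
  split=> [|u v [a ma Na] [b mb Nb]|c u [a ma Na]].
  - exists 0; first exact: ideal_zero.
    by rewrite mul0r subr0; apply: (ideal_zero idN).
  - exists (a + b); first exact: ideal_add.
    by rewrite mulrDl opprD addrACA; apply: (ideal_add idN).
  - exists (c * a); first exact: ideal_scale.
    by rewrite -mulrA -mulrBr; apply: (ideal_scale _ idN).
suff : ideal_mul m (ideal_gen [set` x :: s]) `<=` K by apply.
apply: ideal_mul_sub => // a y ma; rewrite mulrC; move: y.
apply: ideal_gen_sub; first exact: ideal_colon.
move=> y /=; rewrite inE => /orP[/eqP ->|ys].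
  by exists a => //; rewrite mulrC subrr; apply: (ideal_zero idN).
exists 0; first exact: ideal_zero.
rewrite mul0r subr0 mulrC; apply: ideal_mulM => //.
exact: sub_ideal_gen.
Qed.

(** By induction on the generators: as [1 - a] is a unit, the relation for the first generator [x]
    expresses it through [L] and [m] times the other generators. Substituting it gives the same
    hypothesis for the shorter list. *)
Lemma nakayama m L (s : seq R) :
  ideal m -> (forall a, m a -> exists u, u * (1 - a) = 1) -> ideal L ->
  (forall x, x \in s -> ideal_plus L (ideal_mul m (ideal_gen [set` s])) x) ->
  forall x, x \in s -> L x.
Proof.
move=> idm unit idL; elim: s => // x s IHs sL.
set N := ideal_mul m (ideal_gen [set` s]).
have idN : ideal N by apply: ideal_mul_ideal.
have [l Ll /(ideal_mul_cons idm) [a /unit [u ua] Nt]] := sL _ (mem_head x s).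
have xE : x = u * l + u * (x - l - a * x).
  by rewrite -{1}[x]mul1r -ua; ring.
have Ls y : y \in s -> L y.
  move: y; apply: IHs => y ys.
  have [|k Lk /(ideal_mul_cons idm) [b mb Ny]] := sL y.
    by rewrite inE ys orbT.
  exists (k + b * u * l).
    by apply: ideal_add => //; apply: ideal_scale.
  have -> : y - (k + b * u * l) = (y - k - b * x) + b * u * (x - l - a * x).
    by rewrite {1}xE; ring.
  by apply: (ideal_add idN) => //; apply: (ideal_scale _ idN).
have NL : N `<=` L.
  move=> y Ny; have := ideal_mul_subr (ideal_genP _) Ny.
  by move: y {Ny}; apply: ideal_gen_sub.
move=> y; rewrite inE => /orP[/eqP ->|/Ls //]; rewrite xE.
by apply: ideal_add => //; apply: ideal_scale => //; apply: NL.
Qed.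

End Local.

(** * Standard graded rings *)

Section GradedTheory.
Variables (R : comNzRingType) (G : nat -> set R).
Hypothesis Ggr : grading G.
Implicit Types (f g : nat -> R).

Let G0 i : G i 0.
Proof. by have [/(_ i) [/set_mem]] := Ggr. Qed.

Let GB i x y : G i x -> G i y -> G i (x - y).
Proof.
have [/(_ i) [_ GBi] _ _ _ _] := Ggr => Gx Gy.
by apply/set_mem/GBi; apply/mem_set.
Qed.

Let GD i x y : G i x -> G i y -> G i (x + y).
Proof. by move=> Gx Gy; rewrite -[y]opprK -[- y]sub0r; do 2 apply: GB => //. Qed.

Let GM i j x y : G i x -> G j y -> G (i + j)%N (x * y).
Proof. by have [_ _ + _ _] := Ggr; apply. Qed.

(* [f] lists the homogeneous components of [x]. *)
Definition hdec f x := (forall i, G i (f i)) /\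
  exists N, (forall i, (N <= i)%N -> f i = 0) /\ x = \sum_(0 <= i < N) f i.

Lemma hdec_exists x : exists f, hdec f x.
Proof.
have [_ _ _ /(_ x) [n [f [Gf ->]]] _] := Ggr.
exists (fun i => if (i < n)%N then f i else 0); split=> [i|].
  by case: ifP.
exists n; split=> [i|]; first by rewrite leqNgt => /negPf ->.
by apply: eq_big_nat => i /andP[_ ->].
Qed.

Lemma hdec_add f g x y : hdec f x -> hdec g y -> hdec (f \+ g) (x + y).
Proof.
move=> [Gf [N [fN ->]]] [Gg [N' [gN' ->]]]; split=> [i|]; first exact: GD.
have widen h n k : (forall i, (n <= i)%N -> h i = 0) -> (n <= k)%N ->
    \sum_(0 <= i < n) h i = \sum_(0 <= i < k) h i :> R.
  move=> h0 nk; rewrite (big_cat_nat _ nk) //= [X in _ + X]big_nat_cond.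
  by rewrite [X in _ + X]big1 ?addr0 // => i /andP[/andP[/h0]].
exists (maxn N N'); split=> [i|].
  by rewrite geq_max => /andP[/fN /= -> /gN' ->]; rewrite addr0.
rewrite big_split /=; congr (_ + _); apply: widen => //.
  exact: leq_maxl.
exact: leq_maxr.
Qed.

Lemma hdec_opp f x : hdec f x -> hdec (fun i => - f i) (- x).
Proof.
move=> [Gf [N [fN ->]]]; split=> [i|].
  by rewrite -[- _]sub0r; apply: GB.
by exists N; split=> [i /fN ->|]; rewrite ?oppr0 // sumrN.
Qed.

Lemma hdec_homogeneous k x : G k x -> hdec (fun i => if i == k then x else 0) x.
Proof.
move=> Gx; split=> [i|]; first by case: eqP => // ->.
exists k.+1; split=> [i|].
  by case: eqP => // ->; rewrite ltnn.
rewrite big_nat_recr //= eqxx big_nat_cond big1 ?add0r //.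
by move=> i /andP[/andP[_ ik] _]; rewrite ltn_eqF.
Qed.

Lemma hdec_sum n f : (forall i, G i (f i)) ->
  hdec (fun i => if (i < n)%N then f i else 0) (\sum_(0 <= i < n) f i).
Proof.
move=> Gf; split=> [i|]; first by case: ifP.
exists n; split=> [i|]; first by rewrite leqNgt => /negPf ->.
by apply: eq_big_nat => i /andP[_ ->].
Qed.

Lemma hdec_uniq f g x : hdec f x -> hdec g x -> forall i, f i = g i.
Proof.
move=> fx /hdec_opp /(hdec_add fx) [Gh [N [hN]]].
rewrite subrr => /esym h0 i; apply/eqP; rewrite -subr_eq0; apply/eqP.
have [/hN //|iN] := leqP N i.
by have [_ _ _ _ /(_ _ _ Gh h0 _ iN)] := Ggr.
Qed.

(** A constant [H] expresses homogeneity of an ideal, and a degree-dependent [H] gives the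
    filtration by degree. *)
Definition hsums (H : nat -> set R) : set R :=
  [set x | exists2 f, hdec f x & forall i, H i (f i)].

Lemma hsums_homogeneous (H : nat -> set R) k x :
  (forall i, H i 0) -> G k x -> H k x -> hsums H x.
Proof.
move=> H0 Gx Hx; exists (fun i => if i == k then x else 0).
  exact: hdec_homogeneous.
by move=> i; case: eqP => [->|].
Qed.

(** Decomposing both factors reduces stability under multiplication to products of homogeneous
    elements. *)
Lemma hsums_ideal (H : nat -> set R) :
  (forall i, H i 0) -> (forall i x y, H i x -> H i y -> H i (x + y)) ->
  (forall i j a x, G i a -> G j x -> H j x -> H (i + j)%N (a * x)) ->
  ideal (hsums H).
Proof.
move=> H0 HD HM.
have sum0 : hsums H 0 by apply: (hsums_homogeneous (k := 0%N)).
have sumD x y : hsums H x -> hsums H y -> hsums H (x + y).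
  move=> [f fx Hf] [g gy Hg]; exists (f \+ g); first exact: hdec_add.
  by move=> i; apply: HD.
split=> // a x [g [Gg [N [_ ->]]] Hg].
have [f [Gf [N' [_ ->]]]] := hdec_exists a.
rewrite mulr_suml; elim/big_ind: _ => // i _.
rewrite mulr_sumr; elim/big_ind: _ => // j _.
by apply: (hsums_homogeneous (k := (i + j)%N)) => //; [apply: GM|apply: HM].
Qed.

Lemma hsums_const_ideal I : ideal I -> ideal (hsums (fun=> I)).
Proof.
move=> idI; apply: hsums_ideal => [_|_ x y|_ _ a x _ _].
- exact: ideal_zero.
- exact: ideal_add.
- exact: ideal_scale.
Qed.

Lemma homogeneous_idealP I :
  ideal I -> I `<=` hsums (fun=> I) -> homogeneous_ideal G I.
Proof.
move=> idI IH; split=> // n f Gf /IH [g gx Ig] i ni.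
by have := hdec_uniq (hdec_sum n Gf) gx i; rewrite ni => ->.
Qed.

Lemma ideal_gen_homogeneous (S : set R) :
  (forall x, S x -> exists k, G k x) -> homogeneous_ideal G (ideal_gen S).
Proof.
have idS := ideal_genP S.
move=> SG; apply: homogeneous_idealP => //.
apply: ideal_gen_sub; first exact: hsums_const_ideal.
move=> x Sx; have [k Gx] := SG _ Sx.
apply: (hsums_homogeneous (k := k)) => //; last exact: sub_ideal_gen.
by move=> _; apply: (ideal_zero idS).
Qed.

Definition degree_geq n : set R := hsums (fun i => [set x | (i < n)%N -> x = 0]).

Lemma degree_geq_ideal n : ideal (degree_geq n).
Proof.
apply: hsums_ideal => //= [i x y x0 y0 /[dup] /x0 -> /y0 ->|].
  by rewrite addr0.
move=> i j a x _ _ x0 ijn; rewrite x0 ?mulr0 //.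
by apply: leq_ltn_trans ijn; apply: leq_addl.
Qed.

Lemma degree_geqM k l x y :
  degree_geq k x -> degree_geq l y -> degree_geq (k + l) (x * y).
Proof.
move=> [f [Gf [N [_ ->]]] f0] [g [Gg [N' [_ ->]]] g0].
have idD := degree_geq_ideal (k + l).
rewrite mulr_suml; apply: (ideal_sum idD) => i _.
rewrite mulr_sumr; apply: (ideal_sum idD) => j _.
have [ik|ki] := ltnP i k; first by rewrite f0 // mul0r; apply: (ideal_zero idD).
have [jl|lj] := ltnP j l; first by rewrite g0 // mulr0; apply: (ideal_zero idD).
apply: (hsums_homogeneous (k := (i + j)%N)) => //=; first exact: GM.
by rewrite ltnNge leq_add.
Qed.

Lemma degree_geq_eq0 k n x : (k < n)%N -> G k x -> degree_geq n x -> x = 0.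
Proof.
move=> kn Gx [f fx f0]; have := hdec_uniq (hdec_homogeneous Gx) fx k.
by rewrite eqxx f0.
Qed.

(** * The irrelevant ideal of a standard graded ring *)

Let m := irrelevant_ideal G.

Lemma irrelevant_degree_geq : m `<=` degree_geq 1.
Proof.
move=> _ [n [f [Gf ->]]].
have idD := degree_geq_ideal 1.
rewrite big_nat_cond; apply: (ideal_sum idD) => i /andP[/andP[i0 _] _].
by apply: (hsums_homogeneous (k := i)) => //=; rewrite ltnNge i0.
Qed.

Lemma homogeneous_irrelevant k x : (0 < k)%N -> G k x -> m x.
Proof.
move=> k0 Gx; exists k.+1, (fun i => if i == k then x else 0); split.
  by move=> i; case: eqP => // ->.
rewrite big_nat_recr //= eqxx big_nat_cond big1 ?add0r //.
by move=> i /andP[/andP[_ ik] _]; rewrite ltn_eqF.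
Qed.

Hypothesis idm : ideal m.

Lemma irrelevant_sub_component0 f x : hdec f x -> m (x - f 0%N).
Proof.
move=> [Gf [[|N] [fN ->]]].
  by rewrite big_nil fN // subr0; apply: ideal_zero.
rewrite big_nat_recl // addrC addrA addNr add0r.
by apply: ideal_sum => // i _; apply: (@homogeneous_irrelevant i.+1).
Qed.

Lemma irrelevant_pow_degree_geq n : ideal_pow m n `<=` degree_geq n.
Proof.
elim: n => [|n IHn] x.
  by have [f fx] := hdec_exists x; exists f.
move: x; apply: ideal_mul_sub; first exact: degree_geq_ideal.
by move=> x y /irrelevant_degree_geq x1 /IHn yn; apply: degree_geqM 1 n _ _ x1 yn.
Qed.

Hypothesis Gst : standard_graded G.

(** Modulo [m] an element equals its component of degree 0, which is invertible unless it is 0. *)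
Lemma irrelevant_residue_field : residue_field m.
Proof.
have [_ Gfield _] := Gst.
move=> a nma; have [f fa] := hdec_exists a.
have ma := irrelevant_sub_component0 fa.
have [f0|/Gfield [|b _ fb]] := eqVneq (f 0%N) 0; last 2 first.
- by case: fa.
- exists b; have -> : b * a - 1 = b * (a - f 0%N) by rewrite -fb; ring.
  exact: ideal_scale.
by case: nma; rewrite f0 subr0 in ma.
Qed.

(** With [J] generated by the linear forms, [G 0 + J] is a subring containing [G 0] and [G 1], hence
    all of [R]. For an element of [m] the summand from [G 0] lies in [m], so it vanishes by
    degree. *)
Lemma irrelevant_gen : m `<=` ideal_gen (G 1%N).
Proof.
have [_ _ gen01] := Gst; have [_ G1 _ _ _] := Ggr.
set J := ideal_gen (G 1%N); have idJ : ideal J by apply: ideal_genP.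
have Jm : J `<=` m by apply: ideal_gen_sub => // x; apply: homogeneous_irrelevant.
pose T : set R := [set x | exists2 a, G 0%N a & J (x - a)].
have TT : T = setT.
  apply/seteqP; split=> // x _.
  have : setT x by [].
  rewrite -gen01; apply: smallest_sub; last first.
    move=> y [Gy|Gy]; first by exists y => //; rewrite subrr; apply: (ideal_zero idJ).
    by exists 0 => //; rewrite subr0; apply: sub_ideal_gen.
  split=> [|u v /set_mem[a Ga Ja] /set_mem[b Gb Jb]|u v /set_mem[a Ga Ja] /set_mem[b Gb Jb]].
  - by apply/mem_set; exists 1 => //; rewrite subrr; apply: (ideal_zero idJ).
  - apply/mem_set; exists (a - b); first exact: GB.
    have -> : u - v - (a - b) = (u - a) - (v - b) by ring.
    exact: (ideal_sub idJ).
  - apply/mem_set; exists (a * b); first exact: (@GM 0 0).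
    have -> : u * v - a * b = v * (u - a) + a * (v - b) by ring.
    by apply: (ideal_add idJ); apply: (ideal_scale _ idJ).
move=> x mx; have [a Ga Ja] : T x by rewrite TT.
suff a0 : a = 0 by rewrite a0 subr0 in Ja.
apply: (@degree_geq_eq0 0 1) => //; apply: irrelevant_degree_geq.
by rewrite -(subKr x a); apply: ideal_sub => //; apply: Jm.
Qed.

Lemma irrelevant_lift x : m x -> exists2 y, G 1%N y & ideal_pow m 2 (x - y).
Proof.
have idm2 := ideal_pow_ideal m 2.
pose K : set R := [set x | exists2 y, G 1%N y & ideal_pow m 2 (x - y)].
suff : m `<=` K by apply.
move=> {}x /irrelevant_gen; move: x; apply: ideal_gen_sub.
  split=> [|u v [a Ga Ma] [b Gb Mb]|c u [a Ga Ma]].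
  - by exists 0 => //; rewrite subrr; apply: (ideal_zero idm2).
  - exists (a + b); first exact: GD.
    by rewrite opprD addrACA; apply: (ideal_add idm2).
  (* Only the degree 0 component of [c] matters: the rest lies in [m] and multiplies [a] into
     [m^2]. *)
  - have [f fc] := hdec_exists c; exists (f 0%N * a).
      by apply: (@GM 0 1) => //; case: fc.
    have -> : c * u - f 0%N * a = c * (u - a) + (c - f 0%N) * a by ring.
    apply: (ideal_add idm2); first exact: (ideal_scale _ idm2).
    rewrite ideal_pow2 //; apply: ideal_mulM; first exact: irrelevant_sub_component0.
    exact: (@homogeneous_irrelevant 1).
by move=> x Gx; exists x => //; rewrite subrr; apply: (ideal_zero idm2).
Qed.

(** Here a degree count replaces Nakayama's lemma. A product of two linear forms has degree 2, where
    [m^3] has no component, so it is the degree 2 component of an element of the homogeneous ideal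
    [I^2]. *)
Lemma graded_nakayama k (y : 'I_k -> R) : (forall i, G 1%N (y i)) ->
  let I := ideal_gen (range y) in
  ideal_pow m 2 `<=` ideal_plus (ideal_mul I I) (ideal_pow m 3) ->
  homogeneous_ideal G I /\ ideal_pow m 2 `<=` ideal_mul I I.
Proof.
move=> Gy I m2I; split.
  by apply: ideal_gen_homogeneous => _ [i _ <-]; exists 1%N.
set II := ideal_mul I I in m2I *; have idII : ideal II by apply: ideal_mul_ideal.
have IIh : II `<=` hsums (fun=> II).
  apply: ideal_mul_gen_sub; first exact: hsums_const_ideal.
  move=> _ _ [i _ <-] [j _ <-]; apply: (hsums_homogeneous (k := 2)).
  - by move=> _; apply: (ideal_zero idII).
  - exact: (@GM 1 1).
  - by apply: ideal_mulM; apply: sub_ideal_gen; [exists i|exists j].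
rewrite ideal_pow2 // => x mx.
suff : ideal_mul (ideal_gen (G 1%N)) (ideal_gen (G 1%N)) `<=` II.
  by apply; apply: ideal_mul_mono mx; apply: irrelevant_gen.
apply: ideal_mul_gen_sub => // {mx}x z Gx Gz.
have [w IIw /irrelevant_pow_degree_geq [f fxzw f0]] : ideal_plus II (ideal_pow m 3) (x * z).
  apply: m2I; rewrite ideal_pow2 //.
  by apply: ideal_mulM; apply: (@homogeneous_irrelevant 1).
have [g gw IIg] := IIh _ IIw.
have := hdec_add gw fxzw; rewrite addrC subrK => gf.
have := hdec_uniq (hdec_homogeneous (@GM 1 1 _ _ Gx Gz)) gf 2.
by rewrite /= f0 // addr0 => ->.
Qed.

(** Of the components of an element of [I], the one of degree 0 vanishes, those of degree at least 2
    lie in [m^2], and the linear one differs from the element by something in [m^2]. *)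
Lemma between_irrelevant_homogeneous I :
  ideal I -> I `<=` m -> ideal_pow m 2 `<=` I -> homogeneous_ideal G I.
Proof.
move=> idI Im m2I; split=> // n f Gf; set x := \sum_(0 <= i < n) f i => Ix i ni.
have /irrelevant_lift [b Gb m2b] := Im _ Ix.
have [g gxb g0] := irrelevant_pow_degree_geq m2b.
have := hdec_add (hdec_homogeneous Gb) gxb; rewrite addrC subrK.
move=> /(hdec_uniq (hdec_sum n Gf)) /(_ i); rewrite ni.
case: i ni => [|[|i]] ni /=.
- by rewrite g0 // addr0 => ->; apply: ideal_zero.
- rewrite g0 // addr0 => ->; rewrite -(subKr x b).
  by apply: ideal_sub => //; apply: m2I.
- move=> _; apply: m2I.
  have mf : m (f i.+2) by apply: (@homogeneous_irrelevant i.+2).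
  have [c Gc m2c] := irrelevant_lift mf.
  (* The linear form [c] is congruent modulo [m^2] to a form of degree at least 2, so it has no
     component in degree 1. *)
  suff c0 : c = 0 by rewrite c0 subr0 in m2c.
  apply: (@degree_geq_eq0 1 2) => //; rewrite -(subKr (f i.+2) c).
  apply: (ideal_sub (degree_geq_ideal 2)).
    by apply: (hsums_homogeneous (k := i.+2)).
  exact: irrelevant_pow_degree_geq.
Qed.

End GradedTheory.

(** * Invariants of a ring and of its completion *)

Unset Implicit Arguments.

Theorem proposition2p19 (R : comNzRingType) (m : idealr R)
    (R_noeth : noetherian R) :
  (local_ring [set` m] ->
     cs (@ideal R) [set` m] = cs (@ideal (completion m)) (@completion_max R m)
     /\ ms (@ideal R) [set` m]
        = ms (@ideal (completion m)) (@completion_max R m))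
  /\
  (forall G : nat -> set R,
     standard_graded G -> [set` m] = irrelevant_ideal G ->
     cs (homogeneous_ideal G) [set` m]
       = cs (@ideal (completion m)) (@completion_max R m)
     /\ ms (homogeneous_ideal G) [set` m]
       = ms (@ideal (completion m)) (@completion_max R m)).
Proof.
have idm : ideal [set` m] := idealr_ideal m.
(* Index 2 stands for the third power, because of the shift in [quo]. *)
have dense (z : completion m) := to_completion_dense 2 z R_noeth.
have preim3 := @to_completion_preimage R m 2.
split=> [Rloc|G Gst mG].
  have mmax : maximal_ideal [set` m] by apply/Rloc.
  have resm := maximal_residue_field mmax.
  split; apply: min_nat_eq => n [I [idI Im I2 muI]].
  - exact: (cs_extend (phi := to_completion m) dense resm idI Im I2 muI).
  (* In the local case lifts are unrestricted, and Nakayama's lemma is applied to generators of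
     [m^2], with [m^3 = m m^2]. *)
  - apply: (@cs_restrict _ _ (to_completion m) _ idm dense preim3 resm
      (@ideal R) setT I n _ _ idI Im I2 muI).
      move=> x _; exists x => //; rewrite subrr.
      exact: (ideal_zero (ideal_pow_ideal _ _)).
    move=> k y _ _ J m2J; split; first exact: ideal_genP.
    have [s m2s] := R_noeth _ (ideal_pow_ideal [set` m] 2).
    rewrite m2s; apply: ideal_gen_sub; first exact: ideal_mul_ideal.
    apply: (nakayama idm) => [a||x xs]; first exact: local_ring_unit.
      exact: ideal_mul_ideal.
    rewrite -m2s; apply: m2J; rewrite m2s.
    exact: sub_ideal_gen.
  - exact: (ms_extend (phi := to_completion m) dense resm idI Im I2 muI).
  - exact: (ms_restrict (phi := to_completion m) idm dense preim3 resm idI Im I2 muI).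
have [Ggr _ _] := Gst.
have idG : ideal (irrelevant_ideal G) by rewrite -mG.
have resm : residue_field [set` m].
  by rewrite mG; apply: irrelevant_residue_field.
split; apply: min_nat_eq => n [I [idI Im I2 muI]].
- exact: (cs_extend (phi := to_completion m) dense resm idI.1 Im I2 muI).
(* In the graded case the lifts are linear forms, which makes the generated ideal homogeneous. *)
- apply: (@cs_restrict _ _ (to_completion m) _ idm dense preim3 resm
    (homogeneous_ideal G) (G 1%N) I n _ _ idI Im I2 muI).
    by rewrite mG; apply: irrelevant_lift.
  by move=> k y Gy _; rewrite mG; apply: graded_nakayama.
- exact: (ms_extend (phi := to_completion m) dense resm idI.1 Im I2 muI).
- have [k kn [J [idJ Jm m2J muJ]]] :=
    ms_restrict (phi := to_completion m) idm dense preim3 resm idI Im I2 muI.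
  exists k => //; exists J; split=> //.
  by apply: between_irrelevant_homogeneous; rewrite // -mG.
Qed.
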